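(* For any positive integer $n$, the polynomial $$\ell(\Gamma(A_n),x)=\sum_{i=1}^{\lfloor n/2\rfloor}\frac{1}{n-i+1}\binom{n}{i}\binom{n-i-1}{i-1}x^i(1+x)^{n-2i}$$ has only real zeros.
   Context: This polynomial is the local $h$-polynomial of the type $A_n$ cluster subdivision. A polynomial has only real zeros if all of its complex zeros are real. *)

(* Defs.v *)
From HB Require Import structures.
From mathcomp Require Import all_boot all_order all_algebra.
From mathcomp Require Import complex reals.

Set Implicit Arguments.
Unset Strict Implicit.
Unset Printing Implicit Defensive.

Import GRing.Theory Num.Theory.
Local Open Scope ring_scope.
Local Open Scope complex_scope.

(* The local h-polynomial of the cluster subdivision of type A_n, given by its
   explicit gamma-expansion. The subtractions are in nat and never truncate, since 1 <= i <= n./2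
   forces i < n and 2 * i <= n. *)
Definition local_h_cluster_A (R : realType) (n : nat) : {poly R} :=
  \sum_(1 <= i < n./2.+1)
    ((n - i + 1)%N%:R^-1 * 'C(n, i)%:R * 'C(n - i - 1, i - 1)%:R)
      *: ('X^i * (1 + 'X) ^+ (n - 2 * i)).

(* The zero polynomial counts as having only real zeros, by the usual
   convention; it does occur, as local_h_cluster_A R 1. *)
Definition only_real_zeros (R : realType) (p : {poly R}) : Prop :=
  p != 0 ->
  forall z : R[i], root (map_poly (real_complex R) p) z -> complex.Im z = 0.

(* Main.v *)
(* Up to the factor 1/(n+1), [local_h_cluster_A R n] evaluated at z is
   (1 + z)^n K(w), where w = z / (1 + z)^2 and
   K(w) = \sum_i 'C(n+1, i) 'C(n-i-1, i-1) w^i.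
   Without the factor 'C(n+1, i), K is w times a Fibonacci polynomial, which is
   real-rooted by Binet's formula.  Multiplying the i-th coefficient by 'C(N, i)
   preserves real-rootedness, because f' - r f is real-rooted whenever f is and
   r is real (f'/f is not real off the real axis).  Hence w is real; K has
   nonnegative coefficients, so w <= 0, and this forces z to be real. *)
Require Import Defs.
From mathcomp Require Import all_boot all_order all_algebra.
From mathcomp Require Import complex reals.
From mathcomp Require Import ring lra zify.

Set Implicit Arguments.
Unset Strict Implicit.
Unset Printing Implicit Defensive.

Import Order.TTheory GRing.Theory Num.Theory.
Local Open Scope ring_scope.
Local Open Scope complex_scope.

Section RealRooted.
Variable R : realType.
Local Notation C := R[i].
Implicit Types (p q f : {poly C}) (z r : C).

Definition real_rooted p : Prop :=
  p != 0 -> forall z, root p z -> complex.Im z = 0.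

Lemma ImD z r : complex.Im (z + r) = complex.Im z + complex.Im r.
Proof. by case: z; case: r. Qed.

Lemma ImV z : complex.Im z^-1 =
  - complex.Im z / (complex.Re z ^+ 2 + complex.Im z ^+ 2).
Proof. by case: z => x y /=; rewrite mulNr. Qed.

Lemma real_rootedZ (c : C) p : real_rooted p -> real_rooted (c *: p).
Proof.
move=> rp cp0 z; rewrite scaler_eq0 negb_or in cp0; case/andP: cp0 => c0 p0.
by rewrite rootZ //; apply: rp.
Qed.

(* Each summand 1/(z - r) of f'/f has imaginary part of sign opposite to
   that of [Im z], so f'/f takes no real value off the real axis. *)
Lemma Im_logderiv (s : seq C) z :
    (forall r, r \in s -> complex.Im r = 0) -> complex.Im z != 0 ->
  let f := \prod_(r <- s) ('X - r%:P) in
  f.[z] != 0 /\ (if s is [::] then f^`().[z] = 0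
     else complex.Im (f^`().[z] / f.[z]) * complex.Im z < 0).
Proof.
move=> + z0; elim: s => [|r s IHs] rs /=.
  by rewrite big_nil hornerC oner_neq0 derivC hornerC.
have [|f0 IH] := IHs; first by move=> t ts; apply: rs; rewrite in_cons ts orbT.
have r0 := rs r (mem_head _ _).
have zr0 : z - r != 0.
  by apply: contra_neq z0 => /subr0_eq ->.
rewrite big_cons derivM derivXsubC mul1r !hornerE; split; first by rewrite mulf_neq0.
set f := \prod_(_ <- _) _ in f0 IH *.
have -> : (f.[z] + (z - r) * f^`().[z]) / ((z - r) * f.[z])
    = (z - r)^-1 + f^`().[z] / f.[z] by field; rewrite f0 zr0.
rewrite ImD mulrDl -[ltRHS]addr0; apply: ltr_leD.
  rewrite ImV; have -> : complex.Im (z - r) = complex.Im z.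
    by case: (z) (r) r0 => [a b] [c d] /= ->; rewrite subr0.
  rewrite mulNr mulNr oppr_lt0 mulrAC -expr2 divr_gt0 ?exprn_even_gt0 //.
  by rewrite ltr_wpDl ?sqr_ge0 // exprn_even_gt0.
by case: (s) IH => [->|? ? /ltW//]; rewrite mul0r mul0r.
Qed.

Lemma real_rooted_deriv_sub f r :
  complex.Im r = 0 -> real_rooted f -> real_rooted (f^`() - r *: f).
Proof.
have [-> _ _|f0] := eqVneq f 0; first by rewrite deriv0 scaler0 subr0 /real_rooted eqxx.
move=> r0 /(_ f0); have [s] := closed_field_poly_normal f.
have : lead_coef f != 0 by rewrite lead_coef_eq0.
move: (lead_coef f) => l l0 -> rf.
have rs t : t \in s -> complex.Im t = 0.
  by move=> ts; apply: rf; rewrite rootZ // root_prod_XsubC.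
rewrite derivZ scalerA mulrC -scalerA -scalerBr; apply: real_rootedZ => g0 z.
apply: contraTeq => z0.
(* Constant [f] is apart: there f'/f = 0 is real, but f' - r f is then a constant, nonzero by [g0],
   and has no zero. *)
have [h0] := Im_logderiv rs z0; case: (s) g0 h0 => [|t s'].
  rewrite big_nil derivC sub0r => g0 _ _.
  by apply: contra_neqN g0; rewrite rootE !hornerE oppr_eq0 => /eqP ->; rewrite scale0r oppr0.
move=> _; set h := \prod_(_ <- _) _ => h0 hI.
rewrite rootE !hornerE subr_eq0; apply: contraTneq hI => ->.
by rewrite mulfK // r0 mul0r ltxx.
Qed.

(* Up to the factor [N`!], this is the differential operator [p(d/dX)]
   applied to [X^N]. *)
Definition diffX (N : nat) p : {poly C} := \poly_(j < N.+1) (p`_(N - j) / j`!%:R).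

(** [p(d/dX)] is multiplicative in [p], so a factor X - r of [p] acts as d/dX - r. This lets the
    roots of [p] be stripped one at a time, down to a multiple of X^N. *)
Lemma diffX_XsubC N p r :
  diffX N (('X - r%:P) * p) = (diffX N p)^`() - r *: diffX N p.
Proof.
apply/polyP=> j; rewrite coefB coefZ coef_deriv !coef_poly mulrBl coefB coefXM.
rewrite coefCM ltnS; case: ltngtP => [jN|jN|[->]].
- rewrite (ltnW jN : (j <= N)%N) (_ : (N - j == 0)%N = false); last by lia.
  rewrite factS natrM subnS.
  have : j`!%:R != 0 :> C by rewrite pnatr_eq0 -lt0n fact_gt0.
  have : j.+1%:R != 0 :> C by rewrite pnatr_eq0.
  by move=> a b; rewrite -mulr_natr; field; rewrite addrC natr1 a b.
- by rewrite leqNgt (jN : (N < j)%N) mul0rn mulr0 subr0.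
- by rewrite leqnn subnn eqxx mul0rn; ring.
Qed.

Lemma real_rooted_diffX N p : real_rooted p -> real_rooted (diffX N p).
Proof.
have [-> _|p0 /(_ p0)] := eqVneq p 0.
  suff -> : diffX N 0 = 0 by rewrite /real_rooted eqxx.
  by apply/polyP=> j; rewrite coef_poly !coef0 mul0r if_same.
have [s] := closed_field_poly_normal p.
have : lead_coef p != 0 by rewrite lead_coef_eq0.
move: (lead_coef p) => l l0 -> rp.
have {rp} rs t : t \in s -> complex.Im t = 0.
  by move=> ts; apply: rp; rewrite rootZ // root_prod_XsubC.
have -> c q : diffX N (c *: q) = c *: diffX N q.
  by apply/polyP=> j; rewrite coefZ !coef_poly coefZ; case: ifP; rewrite ?mulr0 // mulrA.
apply: real_rootedZ; elim: s rs => [_|r s IHs rs].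
  rewrite big_nil; have -> : diffX N 1 = N`!%:R^-1 *: 'X^N.
    apply/polyP=> j; rewrite coef_poly coefZ coefXn coefC subn_eq0 ltnS.
    by case: ltngtP => // [_|_|->]; rewrite ?mul0r ?mulr0 // mulrC.
  apply: real_rootedZ => _ z; rewrite rootE hornerXn expf_eq0.
  by case/andP=> _ /eqP ->.
rewrite big_cons diffX_XsubC; apply: real_rooted_deriv_sub.
  by apply: rs; rewrite mem_head.
by apply: IHs => t ts; apply: rs; rewrite in_cons ts orbT.
Qed.

(* Applying [diffX N] twice multiplies the [j]-th coefficient by
   1 / (j! (N - j)!). *)
Lemma real_rooted_binom N p :
  real_rooted p -> real_rooted (\poly_(j < N.+1) ('C(N, j)%:R * p`_j)).
Proof.
move=> rp; suff -> : \poly_(j < N.+1) ('C(N, j)%:R * p`_j)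
    = N`!%:R *: diffX N (diffX N p).
  by apply/real_rootedZ/real_rooted_diffX/real_rooted_diffX.
apply/polyP=> j; rewrite coefZ !coef_poly !ltnS; case: leqP => [jN|]; last by rewrite mulr0.
rewrite leq_subr subKn // -(bin_fact jN) !natrM.
have : j`!%:R != 0 :> C by rewrite pnatr_eq0 -lt0n fact_gt0.
have : (N - j)`!%:R != 0 :> C by rewrite pnatr_eq0 -lt0n fact_gt0.
by move=> a b; field; rewrite a b.
Qed.

Definition fib_poly m : {poly C} := \poly_(k < m.+1) 'C(m - k, k)%:R.

Lemma coef_fib_poly m k : (fib_poly m)`_k = 'C(m - k, k)%:R.
Proof.
rewrite coef_poly ltnS; case: leqP => // mk.
by rewrite (eqP (ltnW mk : (m - k == 0)%N)) bin0n; case: k mk.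
Qed.

Lemma fib_polySS m : fib_poly m.+2 = fib_poly m.+1 + 'X * fib_poly m.
Proof.
apply/polyP=> k; rewrite coefD coefXM !coef_fib_poly; case: k => [|k] /=.
  by rewrite !bin0 addr0.
rewrite -natrD; congr _%:R; rewrite !subSS; case: (leqP k m) => km.
  by rewrite subSn // binS addnC.
have -> : (m.+1 - k = 0)%N by lia.
have -> : (m - k = 0)%N by lia.
by case: k km.
Qed.

(* Binet's formula *)
Lemma horner_fib_poly m (a b : C) : a + b = 1 ->
  (a - b) * (fib_poly m).[- (a * b)] = a ^+ m.+1 - b ^+ m.+1.
Proof.
move=> ab; have {ab} -> : b = 1 - a by rewrite -ab; ring.
(* The recurrence has order two, so the induction carries two consecutive cases. *)
suff [] : (a - (1 - a)) * (fib_poly m).[- (a * (1 - a))] = a ^+ m.+1 - (1 - a) ^+ m.+1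
  /\ (a - (1 - a)) * (fib_poly m.+1).[- (a * (1 - a))] = a ^+ m.+2 - (1 - a) ^+ m.+2 by [].
elim: m => [|m [IH1 IH2]].
  have -> : fib_poly 0 = 1.
    by apply/polyP=> -[|k]; rewrite coef_fib_poly coefC.
  have -> : fib_poly 1 = 1.
    by apply/polyP=> -[|[|k]]; rewrite coef_fib_poly coefC.
  by rewrite hornerC; split; ring.
split=> //; rewrite fib_polySS !hornerE mulrDr IH2 mulrCA IH1 !exprS; ring.
Qed.

(** Write a zero as y = - a (1 - a). Binet's formula gives a^(m+1) = (1 - a)^(m+1), so |a| = |1 - a|
    and Re a = 1/2. Then 1 - a is the conjugate of a, and y = - |a|^2 is real. *)
Lemma real_rooted_fib_poly m : real_rooted (fib_poly m).
Proof.
move=> _ y y0.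
have [a] : exists a : C, root ('X^2 - 'X - y%:P) a.
  apply/closed_rootP; rewrite -addrA size_polyDl size_polyXn //.
  by rewrite -opprD size_polyN size_XaddC.
rewrite rootE !hornerE -subr_eq0 subr0 => /eqP ya.
have {}ya : y = - (a * (1 - a)) by rewrite -[y]addr0 -ya; ring.
have := @horner_fib_poly m a (1 - a) (subrKC _ _).
rewrite -ya (rootP y0) mulr0 => /esym/subr0_eq/(congr1 Num.norm)/eqP.
rewrite !normrX eqrXn2 // => /eqP/(congr1 (fun t => t ^+ 2)).
rewrite -!add_Re2_Im2 ya; case: (a) => u v /= [uv].
have -> : u = 1 / 2 by lra.
by field.
Qed.

(** The sign of [w] matters: on the unit circle z / (1 + z)^2 = 1 / |1 + z|^2 is real and
    positive. *)
Lemma Im_eq0_koebe (w : R) z :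
  w <= 0 -> z / (1 + z) ^+ 2 = w%:C -> 1 + z != 0 -> complex.Im z = 0.
Proof.
move=> w0 zw z0; have {zw z0} : z = w%:C * (1 + z) ^+ 2 by rewrite -zw; field.
case: z => a b; rewrite expr2 /= => -[Ea Eb].
have [//|b0] := eqVneq b 0.
have {}Eb : 1 = 2 * w * (1 + a) by apply: (mulfI b0); lra.
(* With w (1 + a) = 1/2, the real part [Ea] becomes (a - 1) / 2 = - w b^2 >= 0. Hence a >= 1, so 2 w
   (1 + a) <= 0, against [Eb]. *)
have : 0 <= - (w * b ^+ 2) by rewrite oppr_ge0 mulr_le0_ge0 ?sqr_ge0.
nra.
Qed.

(** This is K for n = m + 2, in the shape of [real_rooted_binom] with N = n + 1; the factor X
    supplies the shift from i to i - 1 in the second binomial. *)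
Definition cluster_poly m : {poly C} :=
  \poly_(j < m.+4) ('C(m.+3, j)%:R * ('X * fib_poly m)`_j).

Lemma horner_cluster_poly m z : (cluster_poly m).[z] =
  \sum_(1 <= i < m./2.+2) ('C(m.+3, i) * 'C(m.+2 - i - 1, i - 1))%:R * z ^+ i.
Proof.
rewrite horner_poly -(big_mkord xpredT (fun i => 'C(m.+3, i)%:R * ('X * fib_poly m)`_i * z ^+ i)).
rewrite big_ltn // coefXM /= mulr0 mul0r add0r (@big_cat_nat _ _ _ m./2.+2) //=; last by lia.
(* Beyond i = n/2 the Fibonacci coefficients vanish. *)
rewrite [X in _ + X]big_nat_cond [X in _ + X]big1 ?addr0.
  rewrite !big_nat; apply: eq_bigr => -[//|i] _.
  by rewrite coefXM /= coef_fib_poly natrM subnAC !subn1.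
case=> [|i] /andP[/andP[im _] _] //; rewrite coefXM /= coef_fib_poly (@bin_small (m - i)) ?mulr0 ?mul0r //.
have : (m < i.*2)%N by rewrite -ltn_half_double.
by lia.
Qed.

Lemma cluster_poly_gt0 m (w : R) : 0 < w -> 0 < (cluster_poly m).[w%:C].
Proof.
move=> w0; have w0' : 0 < w%:C by rewrite ltcR.
rewrite horner_cluster_poly big_ltn // ltr_wpDr //.
  by apply: sumr_ge0 => i _; rewrite mulr_ge0 ?ler0n // exprn_ge0 // ltW.
by rewrite mulr_gt0 ?exprn_gt0 // ltr0n muln_gt0 !bin_gt0 subnn.
Qed.

Lemma real_rooted_cluster_poly m : real_rooted (cluster_poly m).
Proof.
apply: real_rooted_binom => Xf z; rewrite rootM rootX => /orP[/eqP ->//|].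
by apply: real_rooted_fib_poly; apply: contraNneq Xf => ->; rewrite mulr0.
Qed.

Lemma horner_local_h m z : 1 + z != 0 ->
  (map_poly (real_complex R) (local_h_cluster_A R m.+2)).[z] =
  m.+3%:R^-1 * (1 + z) ^+ m.+2 * (cluster_poly m).[z / (1 + z) ^+ 2].
Proof.
move=> z0; rewrite horner_cluster_poly rmorph_sum horner_sum /= mulr_sumr.
rewrite !big_nat; apply: eq_bigr => i /andP[i1 im].
rewrite natrM map_polyZ !rmorphM !rmorphXn /= map_polyX fmorphV !rmorph_nat.
have -> : map_poly (real_complex R) (1 + 'X) = 1 + 'X.
  by rewrite rmorphD rmorph1 /= map_polyX.
rewrite hornerZ hornerM hornerXn horner_exp hornerD hornerX hornerC.
have -> : (1 + z) ^+ m.+2 = (1 + z) ^+ (m.+2 - 2 * i) * ((1 + z) ^+ 2) ^+ i.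
  by rewrite -exprM -exprD subnK //; lia.
(* The identity (n + 1 - i) C(n+1, i) = (n + 1) C(n, i) absorbs the denominator n - i + 1 and leaves
   the global factor 1/(n+1). *)
have -> : 'C(m.+3, i)%:R = m.+3%:R * 'C(m.+2, i)%:R / (m.+2 - i + 1)%N%:R :> C.
  rewrite -natrM mul_bin_down natrM mulrAC (_ : (m.+3 - i = m.+2 - i + 1)%N); last by lia.
  by rewrite divff ?mul1r // pnatr_eq0 addn1.
rewrite expr_div_n.
have m0 : m.+3%:R != 0 :> C by rewrite pnatr_eq0.
have i0 : (m.+2 - i + 1)%N%:R != 0 :> C by rewrite pnatr_eq0 addn1.
have z2 : ((1 + z) ^+ 2) ^+ i != 0 by rewrite !expf_neq0.
move: m.+3%:R (m.+2 - i + 1)%N%:R (((1 + z) ^+ 2) ^+ i) m0 i0 z2 => a b c m0 i0 z2.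
by field; rewrite m0 i0 z2.
Qed.

End RealRooted.

Theorem theorem3p1 (R : realType) (n : nat) (hn : (0 < n)%N) :
  only_real_zeros (local_h_cluster_A R n).
Proof.
case: n hn => [//|[_|m _ _ z]].
  by rewrite /local_h_cluster_A big_geq // /only_real_zeros eqxx.
(* The point z = -1, where w is not defined, is itself real. *)
have [|z0] := eqVneq (1 + z) 0.
  by case: z => a b [_]; rewrite add0r => ->.
have m0 : m.+3%:R^-1 != 0 :> R[i] by rewrite invr_eq0 pnatr_eq0.
rewrite rootE horner_local_h // mulf_eq0 mulf_eq0 (negPf m0) expf_eq0 (negPf z0) andbF /=.
move=> Kz; have K0 : cluster_poly R m != 0.
  by apply: contraTneq (cluster_poly_gt0 m (@ltr01 R)) => ->; rewrite horner0 ltxx.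
have /= := real_rooted_cluster_poly K0 Kz.
case E: (z / _) Kz => [w y] + /= y0; rewrite {}y0 in E * => Kw.
apply: Im_eq0_koebe E z0.
by rewrite leNgt; apply: contraL Kw => /(cluster_poly_gt0 m)/lt0r_neq0.
Qed.
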